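(* Let the pan be the square $[0,s]^2$ with $s=5.1214$, let $w=0.301$, and consider the inventories $$I_1=\{2,1,0.850,0.849\},\qquad I_2=\{2,1,0.950,0.750\}$$ (all decimals denote exact rationals). Both full inventories are feasible. In $I_1$ the ring of radius $1$ (the pivot) must be placed at the root (the square pan) for the greedy to succeed; in $I_2$ it must be nested in the ring of radius $2$. Hence no state-based placement rule succeeds universally, and every randomized state-based rule has failure probability at least $1/2$ on one of these two instances.
   Context: Model. Fix a width $w>0$ and a pan, here the square $[0,s]^2$ in the plane. An inventory is a finite list of radii $r_1>r_2>\dots>r_n>0$; ring $i$ has outer radius $r_i$ and a hole which is a disk of radius $\max(0,r_i-w)$. A placement of a set $S$ of rings is a forest: each ring of $S$ has as parent either the pan (the root) or another ring of $S$ with $r_{\mathrm{child}}\le r_{\mathrm{parent}}-w$, and the children of each common parent must be packable in the parent's region (the square, or a disk of radius $r-w$ for the hole of a ring of radius $r$), i.e. closed disks having the children's outer radii can be positioned inside that region with pairwise disjoint interiors. Feasibility depends only on the parent assignment (siblings may be rearranged freely). $S$ is feasible if it has a placement. The lex-max set is obtained by scanning the rings in decreasing radius and including ring $i$ whenever the already included rings together with $i$ form a feasible set. A descending greedy processes the rings in decreasing radius; when ring $i$ is processed, a container (the pan or the hole of an already placed ring) admits it if the container's current children together with ring $i$ are packable in it; the ring receives some admitting container as its permanent parent, chosen by the placement rule, and is skipped only if no container admits it. It succeeds if it places exactly the lex-max set and fails otherwise. The observable state at a step consists of the containers, their capacities (hole radius; $s/2$ for the square), their current occupants, the incoming ring,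 the side $s$ and the width $w$ (not the rings still to come). A deterministic state-based rule is a function from states to admitting containers; a randomized state-based rule assigns to each state a probability distribution on admitting containers. *)

(* Defs.v *)
From mathcomp Require Import all_boot all_order all_algebra.
From mathcomp Require Import all_classical all_reals all_analysis.
Set Implicit Arguments.
Unset Strict Implicit.
Unset Printing Implicit Defensive.
Import Order.TTheory GRing.Theory Num.Theory numFieldNormedType.Exports.
Local Open Scope classical_set_scope.
Local Open Scope ring_scope.

Section Geometry.
Variable R : realType.

(* Euclidean: the library norm on R * R is the sup norm. *)
Definition disk (c : R * R) (r : R) : set (R * R) :=
  [set p | (p.1 - c.1) ^+ 2 + (p.2 - c.2) ^+ 2 <= r ^+ 2].

Definition square (s : R) : set (R * R) := `[0, s] `*` `[0, s].

Definition packable (A : set (R * R)) (rs : seq R) : Prop :=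
  exists ctr : nat -> R * R,
    (forall i, (i < size rs)%N -> disk (ctr i) rs`_i `<=` A) /\
    (forall i j, (i < j < size rs)%N ->
       interior (disk (ctr i) rs`_i) `&` interior (disk (ctr j) rs`_j) = set0).

End Geometry.

Section Rings.
Variable R : realType.

Definition is_inventory (inv : seq R) : bool :=
  sorted (fun x y => y < x) inv && all (fun x => 0 < x) inv.

(* The radii of an inventory are distinct, so a ring is named by its outer
   radius.  A container is named by an element of option R, its host: None is
   the pan, and Some r is the hole of the ring of outer radius r.  A forest is a
   parent assignment: the pairs (ring, host of its parent container). *)
Definition forest : Type := seq (R * option R).

Definition rings (f : forest) : seq R := [seq x.1 | x <- f].

Definition hosts (f : forest) : seq (option R) :=
  None :: [seq Some r | r <- rings f].

Definition children (f : forest) (h : option R) : seq R :=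
  [seq x.1 | x <- f & x.2 == h].

Definition capacity (s w : R) (h : option R) : R :=
  if h is Some r then Num.max 0 (r - w) else s / 2.

Definition region (s : R) (h : option R) (cap : R) : set (R * R) :=
  if h is Some _ then disk (0, 0) cap else square s.

(* Acyclicity is not a separate clause: for 0 < w it follows from the bound
   on the radii of child and parent. *)
Definition is_placement (s w : R) (f : forest) : Prop :=
  (forall r q, (r, Some q) \in f -> q \in rings f /\ r <= q - w) /\
  (forall h, h \in hosts f ->
     packable (region s h (capacity s w h)) (children f h)).

Definition feasible (s w : R) (S : seq R) : Prop :=
  exists f : forest, rings f = S /\ is_placement s w f.

Definition lexmax (s w : R) (inv : seq R) : seq R :=
  foldl (fun S r => if `[< feasible s w (rcons S r) >] then rcons S r else S)
    [::] inv.

(* Each container is listed with its capacity and its current occupants. *)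
Record state : Type := State {
  side : R;
  width : R;
  containers : seq (option R * R * seq R);
  incoming : R }.

Definition observe (s w : R) (f : forest) (r : R) : state :=
  State s w [seq (h, capacity s w h, children f h) | h <- hosts f] r.

Definition admits (st : state) (h : option R) : Prop :=
  exists cap occ, (h, cap, occ) \in containers st /\
    packable (region (side st) h cap) (rcons occ (incoming st)).

(* greedy_from s w f rs g: starting from the forest f, some sequence of
   choices of admitting containers for the rings rs leads to the forest g. *)
Inductive greedy_from (s w : R) : forest -> seq R -> forest -> Prop :=
| greedy_done f : greedy_from s w f [::] f
| greedy_place f r rs g h :
    admits (observe s w f r) h ->
    greedy_from s w (rcons f (r, h)) rs g -> greedy_from s w f (r :: rs) g
| greedy_skip f r rs g :
    (forall h, ~ admits (observe s w f r) h) ->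
    greedy_from s w f rs g -> greedy_from s w f (r :: rs) g.

Definition greedy_run (s w : R) (inv : seq R) (g : forest) : Prop :=
  greedy_from s w [::] inv g.

Definition succeeds (s w : R) (inv : seq R) (g : forest) : Prop :=
  rings g =i lexmax s w inv.

(* Values on states without admitting container are irrelevant: there the
   incoming ring is skipped. *)
Definition is_det_rule (rho : state -> option R) : Prop :=
  forall st, (exists h, admits st h) -> admits st (rho st).

Definition det_run (s w : R) (rho : state -> option R) (inv : seq R) : forest :=
  foldl (fun f r =>
      let st := observe s w f r in
      if `[< exists h, admits st h >] then rcons f (r, rho st) else f)
    [::] inv.

Definition state_hosts (st : state) : seq (option R) :=
  undup [seq c.1.1 | c <- containers st].

Definition is_rand_rule (mu : state -> option R -> R) : Prop :=
  forall st, (exists h, admits st h) ->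
    [/\ forall h, 0 <= mu st h,
        forall h, ~ admits st h -> mu st h = 0
      & \sum_(h <- state_hosts st) mu st h = 1].

(* Probability that the run continued from f on the rings rs ends in E, the
   containers being drawn independently at each step given the state. *)
Fixpoint run_prob (s w : R) (mu : state -> option R -> R)
    (E : forest -> Prop) (f : forest) (rs : seq R) : R :=
  if rs is r :: rs' then
    let st := observe s w f r in
    if `[< exists h, admits st h >] then
      \sum_(h <- state_hosts st) mu st h * run_prob s w mu E (rcons f (r, h)) rs'
    else run_prob s w mu E f rs'
  else if `[< E f >] then 1 else 0.

Definition failure_prob (s w : R) (mu : state -> option R -> R)
    (inv : seq R) : R :=
  run_prob s w mu (fun g => ~ succeeds s w inv g) [::] inv.

End Rings.

(* Main.v *)
Require Import Defs.
From mathcomp Require Import all_boot all_order all_algebra.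
From mathcomp Require Import all_classical all_reals all_analysis.
From mathcomp Require Import ring lra.
Import Order.TTheory GRing.Theory Num.Theory numFieldNormedType.Exports.
Local Open Scope ring_scope.

(** The two inventories agree on the rings 2 and 1, so any rule that sees only
    the current state treats the pivot 1 in the same way on both; each choice
    of container for the pivot ruins one inventory.

    - Nested pivot, first inventory.  The hole of 2 has radius 1.699, so it
      cannot take 0.850 or 0.849 beside 1, and the other holes are too small.
      Both would have to join 2 in the square.
    - Rooted pivot, second inventory.  Neither 0.950 nor 0.750 can join 2 and 1
      in the square, and 0.950 + 0.750 exceeds 1.699 by 0.001, so the hole of 2
      cannot hold both; the holes of 1 and 0.950 are too small for either.

    These are [nested_pivot_misses] and [rooted_pivot_misses].  The geometric
    core is [not_packable_square_three]: beside a disk of radius 2 in a square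
    of side 5.1214, each of the two further disks is driven into a corner, and
    the square is too narrow for them to use different corners; in the same
    corner they overlap.  In a hole only a bound on sums of two radii is needed
    ([packable_disk_add_le]).

    Success means placing the whole inventory, because the lex-max set of a
    feasible inventory is the inventory itself ([lexmax_feasible]).  For a
    randomized rule, the first inventory fails at least when the pivot is nested
    and the second at least when it is rooted; these probabilities are the same
    for both inventories and add up to 1. *)

(** * Disks in the plane *)

Section Plane.
Context {R : realType}.
Implicit Types (p q c d : R * R) (a b r s : R).

Definition enorm p : R := Num.sqrt (p.1 ^+ 2 + p.2 ^+ 2).

Lemma enorm_ge0 p : 0 <= enorm p.
Proof. exact: sqrtr_ge0. Qed.

Lemma sqr_enorm p : enorm p ^+ 2 = p.1 ^+ 2 + p.2 ^+ 2.
Proof. by rewrite sqr_sqrtr // addr_ge0 ?sqr_ge0. Qed.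

Lemma enorm_leE p r : 0 <= r ->
  (enorm p <= r) = (p.1 ^+ 2 + p.2 ^+ 2 <= r ^+ 2).
Proof. by move=> r0; rewrite -sqr_enorm ler_sqr ?nnegrE ?enorm_ge0. Qed.

Lemma enorm_ltE p r : 0 <= r ->
  (enorm p < r) = (p.1 ^+ 2 + p.2 ^+ 2 < r ^+ 2).
Proof. by move=> r0; rewrite -sqr_enorm ltr_sqr ?nnegrE ?enorm_ge0. Qed.

Lemma enorm_geE p r : 0 <= r ->
  (r <= enorm p) = (r ^+ 2 <= p.1 ^+ 2 + p.2 ^+ 2).
Proof. by move=> r0; rewrite -sqr_enorm ler_sqr ?nnegrE ?enorm_ge0. Qed.

Lemma enormZ r p : enorm (r * p.1, r * p.2) = `|r| * enorm p.
Proof.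
by rewrite /enorm /= !exprMn -mulrDr sqrtrM ?sqr_ge0 // sqrtr_sqr.
Qed.

Lemma enormN p : enorm (- p) = enorm p.
Proof. by rewrite /enorm /= !sqrrN. Qed.

Lemma enorm_triangle p q : enorm (p + q) <= enorm p + enorm q.
Proof.
rewrite enorm_leE ?addr_ge0 ?enorm_ge0 //= !sqrrD !sqr_enorm.
suff : p.1 * q.1 + p.2 * q.2 <= enorm p * enorm q by nra.
apply: (le_trans (ler_norm _)).
rewrite -ler_sqr ?nnegrE ?mulr_ge0 ?enorm_ge0 //.
rewrite real_normK ?num_real // exprMn !sqr_enorm.
have := sqr_ge0 (p.1 * q.2 - p.2 * q.1); nra.
Qed.

Lemma enorm_distC p q : enorm (p - q) = enorm (q - p).
Proof. by rewrite -opprB enormN. Qed.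

Lemma disk_enorm c r p : 0 <= r -> disk c r p = (enorm (p - c) <= r) :> Prop.
Proof. by move=> r0; rewrite enorm_leE. Qed.

(** A point of the interior can be pushed slightly away from the centre, along
    the ray from the centre, without leaving the disk; hence its distance to
    the centre is not the full radius. *)
Lemma interior_disk c r : 0 < r ->
  interior (disk c r) = [set p | enorm (p - c) < r]%classic.
Proof.
move=> r0; apply/seteqP; split=> p /=.
- move=> pin.
  have [p0|] := leP (enorm (p - c)) 0; first exact: le_lt_trans r0.
  move=> p0.
  pose g (t : R) : R * R := (p.1 + t * (p.1 - c.1), p.2 + t * (p.2 - c.2)).
  have gc : {for 0, continuous g}.
    rewrite /prop_for /continuous_at; apply:
      (@cvg_pair _ _ _ (nbhs (0 : R)) (nbhs (g 0).1) (nbhs (g 0).2)).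
    + apply: cvgD; first exact: cvg_cst.
      by apply: cvgM; [exact: cvg_id | exact: cvg_cst].
    + apply: cvgD; first exact: cvg_cst.
      by apply: cvgM; [exact: cvg_id | exact: cvg_cst].
  have g0 : g 0 = p by rewrite /g !mul0r !addr0; case: (p).
  have : nbhs (0 : R) (g @^-1` disk c r)%classic.
    by apply: gc; rewrite g0; exact: pin.
  move=> /nbhs_ballP[e /= e0 He].
  have : disk c r (g (e / 2)).
    apply: He; rewrite /ball /= sub0r normrN gtr0_norm ?divr_gt0 //; lra.
  rewrite disk_enorm ?(ltW r0) //.
  have -> : g (e / 2) - c = ((1 + e / 2) * (p - c).1, (1 + e / 2) * (p - c).2).
    rewrite /g; case: (c) => c1 c2; case: (p) => p1 p2 /=.
    by congr pair; rewrite /=; lra.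
  rewrite enormZ gtr0_norm; last lra.
  move=> pushed; apply: lt_le_trans pushed; rewrite mulrDl mul1r ltrDl.
  by apply: mulr_gt0; lra.
- move=> pr.
  pose F (q : R * R) : R := (q.1 - c.1) ^+ 2 + (q.2 - c.2) ^+ 2.
  have Fc : continuous F.
    move=> q; apply: cvgD; apply: cvgM; apply: cvgB; try exact: cvg_cst;
      try exact: cvg_fst; exact: cvg_snd.
  have Fo : open (F @^-1` [set x | x < r ^+ 2])%classic.
    by move/continuousP: Fc; apply; exact: open_lt.
  have : (F @^-1` [set x | x < r ^+ 2] `<=` interior (disk c r))%classic.
    by rewrite -open_subsetE // => q /= /ltW.
  by apply; rewrite /= /F; move: pr; rewrite enorm_ltE ?ltW.
Qed.

(** If the centres are closer than [a + b], the point that divides the segment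
    between them in the ratio [a : b] lies in both interiors; the converse is
    the triangle inequality. *)
Lemma interior_disk_disjointP c d a b : 0 < a -> 0 < b ->
  ((interior (disk c a) `&` interior (disk d b) = set0)%classic
   <-> a + b <= enorm (c - d)).
Proof.
move=> a0 b0; rewrite !interior_disk //; split.
- move=> dis; rewrite leNgt; apply/negP => lt.
  have ab : 0 < a + b by lra.
  pose t := a / (a + b); pose u := b / (a + b).
  have tu : t + u = 1 by rewrite /t /u; field; rewrite gt_eqF.
  pose q : R * R := (u * c.1 + t * d.1, u * c.2 + t * d.2).
  suff : (set0 : set (R * R)) q by [].
  rewrite -dis; split=> /=.
  + have -> : q - c = (t * (d - c).1, t * (d - c).2).
      rewrite /q; case: (c) => c1 c2; case: (d) => d1 d2 /=.
      by congr pair; rewrite /= (_ : u = 1 - t); [ring | lra | ring | lra].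
    rewrite enormZ ger0_norm; last by rewrite divr_ge0 //; lra.
    by rewrite enorm_distC /t mulrAC ltr_pdivrMr // ltr_pM2l.
  + have -> : q - d = (u * (c - d).1, u * (c - d).2).
      rewrite /q; case: (c) => c1 c2; case: (d) => d1 d2 /=.
      by congr pair; rewrite /= (_ : t = 1 - u); [ring | lra | ring | lra].
    rewrite enormZ ger0_norm; last by rewrite divr_ge0 //; lra.
    by rewrite /u mulrAC ltr_pdivrMr // ltr_pM2l.
- move=> far; apply/seteqP; split=> // p /= [pc pd].
  have := enorm_triangle (c - p) (p - d).
  by rewrite addrA subrK (enorm_distC c p); lra.
Qed.

(** The point of the disk farthest from the origin has norm [enorm c + r]. *)
Lemma enorm_of_disk_sub c r a : 0 < r -> 0 <= a ->
  (disk c r `<=` disk (0, 0) a)%classic -> enorm c + r <= a.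
Proof.
move=> r0 a0 sub.
have [c0|c0] := leP (enorm c) 0.
(* The centre is the origin, so no ray is singled out and any one serves. *)
- have : disk c r (c.1 + r, c.2) by rewrite /disk /=; nra.
  have := sqr_enorm c; rewrite (_ : enorm c = 0); last first.
    by apply/eqP; rewrite eq_le c0 enorm_ge0.
  rewrite expr0n /= => /esym/eqP; rewrite paddr_eq0 ?sqr_ge0 // !sqrf_eq0.
  case/andP=> /eqP c1 /eqP c2 /sub.
  rewrite /disk /= c1 c2 !subr0 expr0n /= add0r addr0.
  by rewrite ler_sqr ?nnegrE // ltW.
- pose t := 1 + r / enorm c.
  have ct : t * enorm c = enorm c + r.
    by rewrite /t mulrDl mul1r divfK // gt_eqF.
  have t1 : 0 <= t - 1 by rewrite /t addrC addKr divr_ge0 // ltW.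
  have : disk c r (t * c.1, t * c.2).
    rewrite disk_enorm ?(ltW r0) //.
    have -> : (t * c.1, t * c.2) - c = ((t - 1) * c.1, (t - 1) * c.2).
      by case: (c) => c1 c2; congr pair; rewrite /=; ring.
    by rewrite enormZ ger0_norm // mulrBl ct mul1r; lra.
  move=> /sub; rewrite disk_enorm //.
  rewrite (_ : _ - _ = (t * c.1, t * c.2)); last first.
    by congr pair; rewrite /= subr0.
  by rewrite enormZ ger0_norm ?ct //; lra.
Qed.

Lemma disk_sub_disk c r a : 0 <= r -> enorm c + r <= a ->
  (disk c r `<=` disk (0, 0) a)%classic.
Proof.
move=> r0 cra p; have c0 := enorm_ge0 c.
rewrite !disk_enorm //; last lra.
have -> : p - (0, 0) = (p - c) + c.
  by case: (p) => p1 p2; case: (c) => c1 c2; congr pair; rewrite /=; ring.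
by move=> h; have := enorm_triangle (p - c) c; lra.
Qed.

Lemma disk_sub_squareP c r s : 0 < r ->
  (disk c r `<=` square s)%classic <->
  r <= c.1 <= s - r /\ r <= c.2 <= s - r.
Proof.
move=> r0; split.
- move=> sub.
  have inside x y : (x - c.1) ^+ 2 + (y - c.2) ^+ 2 <= r ^+ 2 ->
     0 <= x <= s /\ 0 <= y <= s.
    by move=> /(sub (x, y))[]; rewrite /= !in_itv.
  have [| /andP[h1 _] _] := inside (c.1 - r) c.2; first by nra.
  have [| /andP[_ h2] _] := inside (c.1 + r) c.2; first by nra.
  have [| _ /andP[h3 _]] := inside c.1 (c.2 - r); first by nra.
  have [| _ /andP[_ h4]] := inside c.1 (c.2 + r); first by nra.
  by split; apply/andP; split; lra.
- move=> [/andP[h1 h2] /andP[h3 h4]] [x y]; rewrite /disk /= => h.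
  have hx : `|x - c.1| <= r.
    rewrite -ler_sqr ?nnegrE ?normr_ge0 ?(ltW r0) // real_normK ?num_real //.
    by have := sqr_ge0 (y - c.2); lra.
  have hy : `|y - c.2| <= r.
    rewrite -ler_sqr ?nnegrE ?normr_ge0 ?(ltW r0) // real_normK ?num_real //.
    by have := sqr_ge0 (x - c.1); lra.
  by move: hx hy; rewrite !ler_norml => /andP[? ?] /andP[? ?]; split;
    rewrite /= in_itv /=; lra.
Qed.

End Plane.

(** * Packings in a square and in a disk *)

Section Packings.
Context {R : realType}.
Implicit Types (A : set (R * R)) (rs : seq R) (s a r : R).

Lemma packable_nil A : packable A [::].
Proof. by exists (fun=> 0); split=> // i j; rewrite ltn0 andbF. Qed.

Lemma packable_catl A rs1 rs2 : packable A (rs1 ++ rs2) -> packable A rs1.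
Proof.
move=> [ctr [sub dis]]; exists ctr; split.
- move=> i i1; have := sub i; rewrite size_cat nth_cat i1; apply.
  exact: ltn_addr.
- move=> i j /andP[ij j1]; have := dis i j.
  rewrite size_cat !nth_cat j1 (ltn_trans ij j1); apply.
  by rewrite ij ltn_addr.
Qed.

(** Replaces the topological condition on interiors by the inequality that all
    later estimates use. *)
Lemma packable_distP A rs : all (fun r => 0 < r) rs ->
  packable A rs <-> exists ctr : nat -> R * R,
    (forall i, (i < size rs)%N -> (disk (ctr i) rs`_i `<=` A)%classic) /\
    (forall i j, (i < j < size rs)%N ->
       rs`_i + rs`_j <= enorm (ctr i - ctr j)).
Proof.
move=> /allP pos; split=> -[ctr [sub dis]]; exists ctr; split=> // i j ijn;
  have /andP[ij jn] := ijn; have ni := ltn_trans ij jn.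
- by apply/interior_disk_disjointP; [exact/pos/mem_nth..|exact: dis].
- by apply/interior_disk_disjointP; [exact/pos/mem_nth..|exact: dis].
Qed.

Lemma packable_circles A (cs : seq (R * R * R)) :
  all (fun x => 0 < x.2) cs ->
  {in cs, forall x, (disk x.1 x.2 `<=` A)%classic} ->
  pairwise (fun x y => x.2 + y.2 <= enorm (x.1 - y.1)) cs ->
  packable A [seq x.2 | x <- cs].
Proof.
move=> pos sub /(pairwiseP (0, 0)) far.
apply/packable_distP; first by rewrite all_map.
exists (fun i => (nth (0, 0) cs i).1); rewrite size_map; split.
  by move=> i ics; rewrite (nth_map (0, 0)) //; apply: sub; exact: mem_nth.
move=> i j /andP[ij jcs]; have ics := ltn_trans ij jcs.
by rewrite !(nth_map (0, 0)) //; exact: far.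
Qed.

Lemma packable_disk_le a rs r : all (fun x => 0 < x) rs -> 0 <= a ->
  packable (disk (0, 0) a) rs -> r \in rs -> r <= a.
Proof.
move=> pos a0 [ctr [sub _]] rin.
have := sub (index r rs); rewrite index_mem nth_index // => /(_ rin) subr.
have r0 : 0 < r by exact: (allP pos).
have := enorm_of_disk_sub _ _ _ r0 a0 subr.
by have := enorm_ge0 (ctr (index r rs)); lra.
Qed.

(** The two centres lie within [a - o] and [a - r] of the origin and at least
    [o + r] apart, so [o + r <= (a - o) + (a - r)]. *)
Lemma packable_disk_add_le a occ o r : all (fun x => 0 < x) (rcons occ r) ->
  0 <= a -> packable (disk (0, 0) a) (rcons occ r) -> o \in occ -> o + r <= a.
Proof.
move=> pos a0 /(packable_distP _ _ pos)[ctr [sub dis]] oin.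
set i := index o occ.
have io : (i < size occ)%N by rewrite index_mem.
have ei : (rcons occ r)`_i = o by rewrite nth_rcons io nth_index.
have ej : (rcons occ r)`_(size occ) = r by rewrite nth_rcons ltnn eqxx.
have := dis i (size occ).
rewrite size_rcons io ltnS leqnn ei ej => /(_ isT) far.
have := sub i; rewrite size_rcons ltnS ltnW // ei => /(_ isT) subi.
have := sub (size occ); rewrite size_rcons ltnS leqnn ej => /(_ isT) subj.
have o0 : 0 < o by apply: (allP pos); rewrite mem_rcons inE oin orbT.
have r0 : 0 < r by apply: (allP pos); rewrite mem_rcons inE eqxx.
have := enorm_of_disk_sub _ _ _ o0 a0 subi.
have := enorm_of_disk_sub _ _ _ r0 a0 subj.
have := enorm_triangle (ctr i) (- ctr (size occ)); rewrite enormN; lra.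
Qed.

Lemma sqr_lt_cases (m u : R) : 0 <= m -> m ^+ 2 < u ^+ 2 -> m < u \/ u < - m.
Proof. by move=> m0 mu; case: (ltP m u) => h; [left|right; nra]. Qed.

Lemma sqr_le_of_bounds (x d : R) : - d <= x -> x <= d -> x ^+ 2 <= d ^+ 2.
Proof. by move=> *; nra. Qed.

(** One coordinate of three centres: [x], [y], [z] belong to the disks of radii
    [a], [p], [q].  If [y] and [z] were on opposite sides of [x] they would be
    more than [m + n] apart, while the square leaves them only [s - p - q].  On
    the same side their offsets from [x] lie in the intervals from [m] to
    [s - a - p] and from [n] to [s - a - q], so they differ by at most [d]. *)
Lemma same_side_close s a p q m n d (x y z : R) : 0 <= m -> 0 <= n ->
  s - p - q <= m + n -> s - a - p - n <= d -> s - a - q - m <= d ->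
  a <= x <= s - a -> p <= y <= s - p -> q <= z <= s - q ->
  m ^+ 2 < (y - x) ^+ 2 -> n ^+ 2 < (z - x) ^+ 2 -> (y - z) ^+ 2 <= d ^+ 2.
Proof.
move=> m0 n0 hmn hp hq /andP[? ?] /andP[? ?] /andP[? ?].
move=> /(sqr_lt_cases _ _ m0) my /(sqr_lt_cases _ _ n0) nz.
by apply: sqr_le_of_bounds; case: my; case: nz; lra.
Qed.

(** Neither coordinate of [d - c] can exceed [s - a - p], so when the disks are
    disjoint each of the two coordinates has to contribute more than [m]. *)
Lemma both_coordinates_far s a p m (c d : R * R) :
  (s - a - p) ^+ 2 + m ^+ 2 < (a + p) ^+ 2 ->
  (a + p) ^+ 2 <= (c.1 - d.1) ^+ 2 + (c.2 - d.2) ^+ 2 ->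
  a <= c.1 <= s - a -> a <= c.2 <= s - a ->
  p <= d.1 <= s - p -> p <= d.2 <= s - p ->
  m ^+ 2 < (d.1 - c.1) ^+ 2 /\ m ^+ 2 < (d.2 - c.2) ^+ 2.
Proof.
case: c => c1 c2; case: d => d1 d2 /= hm.
rewrite -[(c1 - d1) ^+ 2]sqrrN -[(c2 - d2) ^+ 2]sqrrN !opprB => far.
move=> /andP[? ?] /andP[? ?] /andP[? ?] /andP[? ?].
have h1 : (d1 - c1) ^+ 2 <= (s - a - p) ^+ 2.
  by apply: sqr_le_of_bounds; lra.
have h2 : (d2 - c2) ^+ 2 <= (s - a - p) ^+ 2.
  by apply: sqr_le_of_bounds; lra.
by split; clear -far hm h1 h2; lra.
Qed.

(** The disk [a] is so large that [p] and [q] are both pushed towards corners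
    of the square, and there is no room for them to use different corners:
    in each coordinate they are on the same side of [a].  Then their centres
    are less than [p + q] apart.  The numbers [m], [n], [d] are rational
    witnesses for the square roots in this argument. *)
Lemma not_packable_square_three s a p q m n d :
  0 < a -> 0 < p -> 0 < q -> 0 <= m -> 0 <= n ->
  (s - a - p) ^+ 2 + m ^+ 2 < (a + p) ^+ 2 ->
  (s - a - q) ^+ 2 + n ^+ 2 < (a + q) ^+ 2 ->
  s - p - q <= m + n ->
  s - a - p - n <= d -> s - a - q - m <= d -> d ^+ 2 + d ^+ 2 < (p + q) ^+ 2 ->
  ~ packable (square s) [:: a; p; q].
Proof.
move=> a0 p0 q0 m0 n0 hm hn hmn hd1 hd2 hd.
move/packable_distP => /=; rewrite a0 p0 q0 => /(_ isT)[ctr [sub far]].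
have /(disk_sub_squareP _ _ _ a0) := sub 0%N isT.
have /(disk_sub_squareP _ _ _ p0) := sub 1%N isT.
have /(disk_sub_squareP _ _ _ q0) := sub 2%N isT.
have := far 0%N 1%N isT; have := far 0%N 2%N isT; have := far 1%N 2%N isT.
rewrite /= !enorm_geE ?addr_ge0 ?(ltW a0) ?(ltW p0) ?(ltW q0) //.
case: (ctr 0%N) => a1 a2; case: (ctr 1%N) => b1 b2; case: (ctr 2%N) => c1 c2 /=.
move=> fbc fac fab [hc1 hc2] [hb1 hb2] [ha1 ha2].
have [fb1 fb2] := both_coordinates_far s a p m (a1, a2) (b1, b2)
  hm fab ha1 ha2 hb1 hb2.
have [fc1 fc2] := both_coordinates_far s a q n (a1, a2) (c1, c2)
  hn fac ha1 ha2 hc1 hc2.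
have close := same_side_close _ _ _ _ _ _ _ _ _ _ m0 n0 hmn hd1 hd2.
have := close _ _ _ ha1 hb1 hc1 fb1 fc1.
have := close _ _ _ ha2 hb2 hc2 fb2 fc2.
clear -fbc hd; lra.
Qed.

End Packings.

(** * Forests and greedy runs *)

Section Greedy.
Context {R : realType}.
Implicit Types (s w r a p x y : R) (f g : forest R) (h : option R).
Implicit Types (inv rs : seq R).

Lemma children_rcons f r h' h :
  children (rcons f (r, h')) h =
  if h' == h then rcons (children f h) r else children f h.
Proof.
by rewrite /children filter_rcons /=; case: ifP => // _; rewrite map_rcons.
Qed.

Lemma rings_rcons f r h : rings (rcons f (r, h)) = rcons (rings f) r.
Proof. by rewrite /rings map_rcons. Qed.

Lemma admitsP s w f r h :
  admits (observe s w f r) h <->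
  h \in hosts f /\
  packable (region s h (capacity s w h)) (rcons (children f h) r).
Proof.
split=> [ [cap [occ [/mapP[k kf [-> -> ->]] pk]]]|[hf pk]] //.
by exists (capacity s w h), (children f h); split=> //; apply/mapP; exists h.
Qed.

Lemma admits_hole s w f r q : all (fun x => 0 < x) (rcons (rings f) r) ->
  admits (observe s w f r) (Some q) ->
  [/\ q \in rings f, r <= q - w &
      forall o, (o, Some q) \in f -> o + r <= q - w].
Proof.
rewrite all_rcons => /andP[r0 /allP pos] /admitsP[].
rewrite inE /= mem_map; last by move=> u v [->].
move=> qf pk.
have c0 : 0 <= Num.max 0 (q - w) by rewrite le_max lexx.
have posc : all (fun x => 0 < x) (rcons (children f (Some q)) r).
  rewrite all_rcons r0; apply/allP => o /mapP[ [b h] /=].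
  rewrite mem_filter => /andP[_ bf] ->; apply: pos.
  by apply/mapP; exists (b, h).
split=> //.
- have : r \in rcons (children f (Some q)) r by rewrite mem_rcons inE eqxx.
  move=> /(packable_disk_le _ _ _ posc c0 pk).
  by rewrite le_max leNgt r0.
- move=> o oq.
  have oc : o \in children f (Some q).
    by apply/mapP; exists (o, Some q) => //; rewrite mem_filter eqxx.
  have o0 : 0 < o by apply: pos; apply/mapP; exists (o, Some q).
  have := packable_disk_add_le _ _ _ _ posc c0 pk oc.
  by rewrite le_max => /orP[|//]; lra.
Qed.

(** The smallest ring is no parent, since a parent is wider than its child by
    [w > 0]; deleting it therefore leaves a forest. *)
Lemma feasible_rcons_inv s w rs r : 0 < w ->
  all (fun x => r < x) rs -> feasible s w (rcons rs r) -> feasible s w rs.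
Proof.
move=> w0 /allP small [f []]; case/lastP: f => [|f [r' h] ].
  by case: rs {small}.
rewrite rings_rcons => /rcons_inj[frs ->] [nest pack].
exists f; split=> //; split.
- move=> x q xq; have [] := nest x q; first by rewrite mem_rcons inE xq orbT.
  rewrite rings_rcons mem_rcons inE => /orP[/eqP ->|//] xr.
  have : r < x by apply: small; rewrite -frs; apply/mapP; exists (x, Some q).
  by lra.
- move=> k kf.
  have : packable (region s k (capacity s w k)) (children (rcons f (r, h)) k).
    apply: pack; move: kf; rewrite !inE rings_rcons map_rcons mem_rcons inE.
    by case/orP=> ->; rewrite ?orbT.
  rewrite children_rcons; case: ifP => // _; rewrite -cats1.
  exact: packable_catl.
Qed.

Lemma lexmax_feasible s w inv : 0 < w -> is_inventory inv ->
  feasible s w inv -> lexmax s w inv = inv.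
Proof.
move=> w0 /andP[]; rewrite sorted_pairwise; last by move=> x y z /= ? ?; lra.
move=> + _; elim/last_ind: inv => [//|inv r IH].
rewrite pairwise_rcons => /andP[small srt] feas.
rewrite /lexmax -cats1 foldl_cat -/(lexmax s w inv) /= IH //.
  by rewrite cats1 asboolT.
exact: feasible_rcons_inv feas.
Qed.

Lemma greedy_nil_inv s w f g : greedy_from s w f [::] g -> g = f.
Proof. by move=> H; inversion H. Qed.

Lemma greedy_cons_inv s w f r rs g : greedy_from s w f (r :: rs) g ->
  (exists h, admits (observe s w f r) h /\
     greedy_from s w (rcons f (r, h)) rs g) \/
  ((forall h, ~ admits (observe s w f r) h) /\ greedy_from s w f rs g).
Proof. by move=> H; inversion H; [left; exists h|right]. Qed.

Lemma greedy_new s w f rs g r h : greedy_from s w f rs g ->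
  (r, h) \in g -> (r, h) \in f \/ r \in rs.
Proof.
elim=> {f rs g} [f|f r' rs g h' _ _ IH|f r' rs g _ _ IH] /=; first by left.
- case/IH=> [|H]; last by right; rewrite inE H orbT.
  rewrite mem_rcons !inE => /orP[/eqP[-> _]|->]; last by left.
  by rewrite eqxx; right.
- by case/IH=> [|H]; [left|right; rewrite inE H orbT].
Qed.

Lemma greedy_sub s w f rs g : greedy_from s w f rs g -> {subset f <= g}.
Proof.
elim=> {f rs g} [f|f r rs g h _ _ IH|//] x; first by [].
by move=> xf; apply: IH; rewrite mem_rcons inE xf orbT.
Qed.

(** A ring is offered a container only at its own step, so if it occurs in the
    outcome then it was placed at that step. *)
Lemma greedy_placed s w f r rs g : greedy_from s w f (r :: rs) g ->
  r \in rings g -> r \notin rings f -> r \notin rs ->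
  exists h, admits (observe s w f r) h /\
    greedy_from s w (rcons f (r, h)) rs g.
Proof.
move=> /greedy_cons_inv[//|[_ gr]] /mapP[ [b h] /= bg rb] rf rrs.
move: bg; rewrite -rb => /(greedy_new _ _ _ _ _ _ _ gr)[rhf|rin].
  by case/negP: rf; apply/mapP; exists (r, h).
by rewrite rin in rrs.
Qed.

(** With the pivot [p] in the hole of [a], neither [x] nor [y] fits beside it,
    and the holes of [p] and [x] are too small for them.  So both would have to
    lie in the square next to [a]. *)
Lemma nested_pivot_misses s w a p x y g :
  0 < y -> y < x -> x < p -> p < a ->
  a - w < p + y -> p - w < y -> x - w < y ->
  ~ packable (square s) [:: a; x; y] ->
  greedy_from s w [:: (a, None); (p, Some a)] [:: x; y] g ->
  ~ (rings g =i [:: a; p; x; y]).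
Proof.
move=> y0 yx xp pa hay hpy hxy unp gr all_placed.
have xg : x \in rings g by rewrite all_placed !inE eqxx !orbT.
have yg : y \in rings g by rewrite all_placed !inE eqxx !orbT.
have pos : all (fun z => 0 < z) [:: a; p; x; y].
  by rewrite /= !andbT; apply/and4P; split; lra.
have /and3P[xa ya yp] : [&& x < a, y < a & y < p] by apply/and3P; split; lra.
have [] := greedy_placed _ _ _ _ _ _ gr xg; rewrite /= ?inE ?(lt_eqF xa)
  ?(lt_eqF xp) ?(gt_eqF yx) // => hx [adx {}gr].
have [] := greedy_placed _ _ _ _ _ _ gr yg; rewrite /= ?inE ?(lt_eqF ya)
  ?(lt_eqF yp) ?(lt_eqF yx) // => hy [ady _].
case: hx adx ady {gr} => [q /admits_hole|_].
  move=> /(_ ltac:(by move: pos; rewrite /= => /and4P[-> -> ->]))[].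
  rewrite /= !inE => /orP[] /eqP ->; last by lra.
  by move=> _ /(_ p); rewrite !inE eqxx orbT => /(_ isT); lra.
case: hy => [q /admits_hole|/admitsP[_ //]].
move=> /(_ pos)[]; rewrite /= !inE => /or3P[] /eqP ->; try lra.
by move=> _ /(_ p); rewrite !inE eqxx orbT => /(_ isT); lra.
Qed.

(** With the pivot [p] in the square, neither [x] nor [y] fits in the square
    beside [a] and [p], and the holes of [p] and [x] are too small for them.  So
    both would have to lie in the hole of [a]. *)
Lemma rooted_pivot_misses s w a p x y g :
  0 < y -> y < x -> x < p -> p < a ->
  a - w < x + y -> p - w < y -> x - w < y ->
  ~ packable (square s) [:: a; p; x] ->
  ~ packable (square s) [:: a; p; y] ->
  greedy_from s w [:: (a, None); (p, None)] [:: x; y] g ->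
  ~ (rings g =i [:: a; p; x; y]).
Proof.
move=> y0 yx xp pa hay hpy hxy unpx unpy gr all_placed.
have xg : x \in rings g by rewrite all_placed !inE eqxx !orbT.
have yg : y \in rings g by rewrite all_placed !inE eqxx !orbT.
have pos : all (fun z => 0 < z) [:: a; p; x; y].
  by rewrite /= !andbT; apply/and4P; split; lra.
have /and3P[xa ya yp] : [&& x < a, y < a & y < p] by apply/and3P; split; lra.
have [] := greedy_placed _ _ _ _ _ _ gr xg; rewrite /= ?inE ?(lt_eqF xa)
  ?(lt_eqF xp) ?(gt_eqF yx) // => hx [adx {}gr].
have [] := greedy_placed _ _ _ _ _ _ gr yg; rewrite /= ?inE ?(lt_eqF ya)
  ?(lt_eqF yp) ?(lt_eqF yx) // => hy [ady _].
case: hx adx ady {gr} => [q /admits_hole|/admitsP[_ //]].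
move=> /(_ ltac:(by move: pos; rewrite /= => /and4P[-> -> ->]))[].
rewrite /= !inE => /orP[] /eqP ->; last by lra.
move=> _ _; case: hy => [u /admits_hole|/admitsP[_ //]].
move=> /(_ pos)[]; rewrite /= !inE => /or3P[] /eqP ->; try lra.
by move=> _ /(_ x); rewrite !inE eqxx !orbT => /(_ isT); lra.
Qed.

Lemma greedy_two_inv s w a p rs g : packable (square s) [:: a] ->
  packable (square s) [:: a; p] ->
  greedy_run s w [:: a, p & rs] g ->
  greedy_from s w [:: (a, None); (p, None)] rs g \/
  greedy_from s w [:: (a, None); (p, Some a)] rs g.
Proof.
move=> pa pap /greedy_cons_inv[ [h [/admitsP[]]]|[/(_ None) []]]; last first.
  by apply/admitsP.
rewrite inE => /eqP-> _ /greedy_cons_inv[ [k [/admitsP[]]]|[/(_ None) []]].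
- by rewrite !inE => /orP[] /eqP-> _; [left|right].
- by apply/admitsP.
Qed.

Lemma det_run_greedy s w rho inv : is_det_rule rho ->
  greedy_run s w inv (det_run s w rho inv).
Proof.
move=> rule; rewrite /greedy_run /det_run.
elim: inv [::] => [|r rs IH] f /=; first exact: greedy_done.
case: asboolP => adm; last first.
  by apply: greedy_skip (IH f) => h hadm; apply: adm; exists h.
exact: greedy_place (rule _ adm) (IH _).
Qed.

Lemma det_run_cat s w rho inv rs : is_det_rule rho ->
  greedy_from s w (det_run s w rho inv) rs (det_run s w rho (inv ++ rs)).
Proof.
move=> rule; rewrite /det_run foldl_cat; move: (foldl _ [::] inv).
elim: rs => [|r rs IH] f /=; first exact: greedy_done.
case: asboolP => adm; last first.
  by apply: greedy_skip (IH f) => h hadm; apply: adm; exists h.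
exact: greedy_place (rule _ adm) (IH _).
Qed.

Lemma run_prob_ge0 s w mu (E : forest R -> Prop) f rs :
  is_rand_rule mu -> 0 <= run_prob s w mu E f rs.
Proof.
move=> rule; elim: rs f => [|r rs IH] f /=; first by case: asboolP.
case: asboolP => // /rule[mu0 _ _].
by apply: sumr_ge0 => h _; rewrite mulr_ge0.
Qed.

(** Every branch of positive probability is a run of the nondeterministic
    greedy, so an event shared by all these runs is certain. *)
Lemma run_prob_sure s w mu (E : forest R -> Prop) f rs :
  is_rand_rule mu -> (forall g, greedy_from s w f rs g -> E g) ->
  run_prob s w mu E f rs = 1.
Proof.
move=> rule; elim: rs f => [|r rs IH] f sure /=.
  by rewrite asboolT //; apply: sure; exact: greedy_done.
case: asboolP => adm; last first.
  apply: IH => g gr; apply: sure; apply: greedy_skip gr => h hadm.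
  by apply: adm; exists h.
have [_ mu0 <-] := rule _ adm; apply: eq_bigr => h _.
have [hadm|nadm] := pselect (admits (observe s w f r) h).
  rewrite IH ?mulr1 // => g gr; apply: sure; exact: greedy_place gr.
by rewrite mu0 // mul0r.
Qed.

Lemma state_hosts_observe s w f r :
  state_hosts (observe s w f r) = undup (hosts f).
Proof. by rewrite /state_hosts /observe /= -map_comp map_id. Qed.

(** The first ring can only go to the pan, so the randomness starts at the
    pivot.  The state [st] there does not involve [rs], hence is the same for
    two inventories that begin with [a] and [p]. *)
Lemma failure_prob_pivot s w mu a p rs : is_rand_rule mu ->
  packable (square s) [:: a] -> packable (square s) [:: a; p] ->
  let E g := ~ succeeds s w [:: a, p & rs] g in
  let st := observe s w [:: (a, None)] p in
  failure_prob s w mu [:: a, p & rs] =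
    mu st None * run_prob s w mu E [:: (a, None); (p, None)] rs +
    mu st (Some a) * run_prob s w mu E [:: (a, None); (p, Some a)] rs.
Proof.
move=> rule pa pap E st; rewrite /failure_prob /= -/E.
have adm0 : exists h, admits (observe s w [::] a) h.
  by exists None; apply/admitsP.
have adm1 : exists h, admits st h by exists None; apply/admitsP.
rewrite asboolT //.
have [_ _] := rule _ adm0; rewrite !state_hosts_observe !big_seq1 => ->.
by rewrite mul1r asboolT // /hosts /= big_cons big_seq1.
Qed.

Lemma pivot_probs s w mu a p : is_rand_rule mu ->
  packable (square s) [:: a; p] ->
  let st := observe s w [:: (a, None)] p in
  [/\ 0 <= mu st None, 0 <= mu st (Some a) & mu st None + mu st (Some a) = 1].
Proof.
move=> rule pap st.
have [] := rule st; first by exists None; apply/admitsP.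
move=> mu0 _; rewrite /st state_hosts_observe /hosts /= big_cons big_seq1.
by split.
Qed.

End Greedy.

(** * The two inventories *)

Section Instances.
Context {R : realType}.

Let s : R := 5 + 1214 / 10 ^+ 4.
Let w : R := 301 / 1000.
Let I1 : seq R := [:: 2; 1; 850 / 1000; 849 / 1000].
Let I2 : seq R := [:: 2; 1; 950 / 1000; 750 / 1000].

Let w_gt0 : 0 < w. Proof. by rewrite /w; lra. Qed.

Lemma inventory1 : is_inventory I1.
Proof. by rewrite /is_inventory /= !andbT; apply/andP; split; lra. Qed.

Lemma inventory2 : is_inventory I2.
Proof. by rewrite /is_inventory /= !andbT; apply/andP; split; lra. Qed.

(** Opposite corners; the fit is tight, as two disks of radii 2 and 1 need a
    side of at least [3 * (1 + 1 / sqrt 2)], about 5.12132. *)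
Lemma packable_two_one : packable (square s) [:: 2; 1].
Proof.
apply: (packable_circles _ [:: ((2, 2), 2); ((s - 1, s - 1), 1)]).
- by rewrite /= ltr0n ltr01.
- by move=> x; rewrite !inE => /orP[] /eqP -> /=; apply/disk_sub_squareP => //=;
    split; rewrite /s; lra.
- by rewrite /= !andbT enorm_geE /= /s; lra.
Qed.

Lemma packable_two : packable (square s) [:: 2].
Proof. exact: (@packable_catl _ _ [:: 2] [:: 1] packable_two_one). Qed.

Lemma capacity_hole q : w <= q -> capacity s w (Some q) = q - w.
Proof. by move=> wq; rewrite /capacity max_r // subr_ge0. Qed.

(** The rings 2 and 1 share the square, and the two others exactly fill a
    diameter of the hole of 2, because 0.850 + 0.849 = 2 - 0.301. *)
Lemma feasible1 : feasible s w I1.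
Proof.
exists [:: (2, None); (1, None); (850 / 1000, Some 2); (849 / 1000, Some 2)].
split=> //; split.
- move=> r q; rewrite !inE /= => /or4P[] /eqP // [-> ->];
    by rewrite eqxx; split=> //; rewrite /w; lra.
- have neq (u v : R) : u < v -> (Some v == Some u) = false.
    by move=> uv; apply/eqP => -[]; lra.
  move=> h; rewrite inE => /orP[/eqP ->|/mapP[q]].
    exact: packable_two_one.
  rewrite !inE /= => /or4P[] /eqP -> ->; last first.
  + by rewrite /children /= !neq; [exact: packable_nil|lra..].
  + by rewrite /children /= !neq; [exact: packable_nil|lra..].
  + by rewrite /children /= !neq; [exact: packable_nil|lra..].
  rewrite capacity_hole; last by rewrite /w; lra.
  rewrite /children /= eqxx /=.
  apply: (packable_circles _ [:: ((- (849 / 1000), 0), 850 / 1000);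
                                 ((850 / 1000, 0), 849 / 1000)]).
  + by rewrite /= !andbT; apply/andP; split; lra.
  + move=> x; rewrite !inE => /orP[] /eqP -> /=;
      (apply: disk_sub_disk; first by lra);
      by rewrite -lerBrDr enorm_leE /= /w; lra.
  + by rewrite /= !andbT enorm_geE /=; lra.
Qed.

(** The ring 1 is nested in 2, the ring 2 touches the bottom side of the square,
    and the two others lie in the upper corners. *)
Lemma feasible2 : feasible s w I2.
Proof.
exists [:: (2, None); (1, Some 2); (950 / 1000, None); (750 / 1000, None)].
split=> //; split.
- move=> r q; rewrite !inE /= => /or4P[] /eqP // [-> ->];
    by rewrite eqxx; split=> //; rewrite /w; lra.
- have neq (u v : R) : u < v -> (Some v == Some u) = false.
    by move=> uv; apply/eqP => -[]; lra.
  move=> h; rewrite inE => /orP[/eqP ->|/mapP[q]].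
    rewrite /children /=.
    (* The disks in the corners keep the centre of the large one to abscissas
       between about 2.947 and 2.979. *)
    apply: (packable_circles _ [:: ((296 / 100, 2), 2);
      ((950 / 1000, s - 950 / 1000), 950 / 1000);
      ((s - 750 / 1000, s - 750 / 1000), 750 / 1000)]).
    + by rewrite /= !andbT; apply/and3P; split; lra.
    + by move=> x; rewrite !inE => /or3P[] /eqP -> /=;
        (apply/disk_sub_squareP; first by lra); split; rewrite /= /s; lra.
    + by rewrite /= !andbT -andbA; apply/and3P; split;
        rewrite enorm_geE /= /s; lra.
  rewrite !inE /= => /or4P[] /eqP -> ->; last first.
  + by rewrite /children /= !neq; [exact: packable_nil|lra..].
  + by rewrite /children /= !neq; [exact: packable_nil|lra..].
  + by rewrite /children /= !neq; [exact: packable_nil|lra..].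
  rewrite capacity_hole; last by rewrite /w; lra.
  rewrite /children /= eqxx /=.
  apply: (packable_circles _ [:: ((0, 0), 1)]) => //=; first by rewrite ltr01.
  move=> x; rewrite inE => /eqP -> /=; apply: disk_sub_disk; first by lra.
  by rewrite -lerBrDr enorm_leE /= /w; lra.
Qed.

Lemma nested_pivot_fails g :
  greedy_from s w [:: (2, None); (1, Some 2)] [:: 850 / 1000; 849 / 1000] g ->
  ~ succeeds s w I1 g.
Proof.
move=> gr; rewrite /succeeds lexmax_feasible //;
  [| exact: inventory1 | exact: feasible1].
apply: (nested_pivot_misses _ _ _ _ _ _ _ _ _ _ _ _ _ _ _ gr);
  rewrite /w; try lra.
(* Here and below [m] and [n] approximate from below the square roots of
   [(2 + r) ^+ 2 - (s - 2 - r) ^+ 2], [r] being the radii of the two disks. *)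
apply: (not_packable_square_three _ _ _ _ (172 / 100) (1718 / 1000) (56 / 100));
  by rewrite /s; lra.
Qed.

Lemma rooted_pivot_fails g :
  greedy_from s w [:: (2, None); (1, None)] [:: 950 / 1000; 750 / 1000] g ->
  ~ succeeds s w I2 g.
Proof.
move=> gr; rewrite /succeeds lexmax_feasible //;
  [| exact: inventory2 | exact: feasible2].
apply: (rooted_pivot_misses _ _ _ _ _ _ _ _ _ _ _ _ _ _ _ _ gr);
  rewrite /w; try lra.
- apply: (not_packable_square_three _ _ _ _ (212 / 100) (199 / 100) (80 / 100));
    by rewrite /s; lra.
- apply: (not_packable_square_three _ _ _ _ (212 / 100) (139 / 100) (80 / 100));
    by rewrite /s; lra.
Qed.

Lemma pivot_rooted1 g : greedy_run s w I1 g -> succeeds s w I1 g ->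
  (1, None) \in g.
Proof.
move=> /(greedy_two_inv _ _ _ _ _ _ packable_two packable_two_one)[gr _|gr].
  by apply: (greedy_sub _ _ _ _ _ gr); rewrite !inE eqxx orbT.
by move/(nested_pivot_fails _ gr).
Qed.

Lemma pivot_nested2 g : greedy_run s w I2 g -> succeeds s w I2 g ->
  (1, Some 2) \in g.
Proof.
move=> /(greedy_two_inv _ _ _ _ _ _ packable_two packable_two_one)[gr|gr _].
  by move/(rooted_pivot_fails _ gr).
by apply: (greedy_sub _ _ _ _ _ gr); rewrite !inE eqxx orbT.
Qed.

(** On the two inventories the rule goes through the same states up to and
    including the placement of the pivot, and either choice there is fatal for
    one of them. *)
Lemma no_det_rule rho : is_det_rule rho ->
  succeeds s w I1 (det_run s w rho I1) ->
  ~ succeeds s w I2 (det_run s w rho I2).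
Proof.
move=> rule ok1 ok2.
have [|gr] := greedy_two_inv _ _ _ _ _ _ packable_two packable_two_one
  (det_run_greedy s w rho [:: 2; 1] rule).
- move/greedy_nil_inv => start.
  apply: (rooted_pivot_fails _ _ ok2); rewrite -start.
  exact: (det_run_cat _ _ _ [:: 2; 1]).
- apply: (nested_pivot_fails _ _ ok1); rewrite -(greedy_nil_inv _ _ _ _ gr).
  exact: (det_run_cat _ _ _ [:: 2; 1]).
Qed.

(** The probabilities [u] and [v] of rooting and of nesting the pivot are the
    same for both inventories; the first inventory fails with probability at
    least [v], the second with probability at least [u]. *)
Lemma rand_rule_fails mu : is_rand_rule mu ->
  1 / 2 <= failure_prob s w mu I1 \/ 1 / 2 <= failure_prob s w mu I2.
Proof.
move=> rule.
rewrite !(failure_prob_pivot _ _ _ _ _ _ rule packable_two packable_two_one).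
rewrite (run_prob_sure s w mu _ [:: (2, None); (1, Some 2)]
  [:: 850 / 1000; 849 / 1000] rule nested_pivot_fails).
rewrite (run_prob_sure s w mu _ [:: (2, None); (1, None)]
  [:: 950 / 1000; 750 / 1000] rule rooted_pivot_fails).
have [] := pivot_probs s w mu 2 1 rule packable_two_one.
set u := mu _ None; set v := mu _ (Some 2) => u0 v0 uv.
rewrite !mulr1.
set P := run_prob _ _ _ _ _ _; set Q := run_prob _ _ _ _ _ _.
have uP : 0 <= u * P by rewrite mulr_ge0 // run_prob_ge0.
have vQ : 0 <= v * Q by rewrite mulr_ge0 // run_prob_ge0.
by case: (leP (1 / 2) v) => ?; [left|right]; lra.
Qed.

End Instances.

Theorem theorem37 (R : realType) :
  let s : R := 5 + 1214 / 10 ^+ 4 in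
  let w : R := 301 / 1000 in
  let I1 : seq R := [:: 2; 1; 850 / 1000; 849 / 1000] in
  let I2 : seq R := [:: 2; 1; 950 / 1000; 750 / 1000] in
  [/\ feasible s w I1 /\ feasible s w I2,
      forall g, greedy_run s w I1 g -> succeeds s w I1 g -> (1, None) \in g,
      forall g, greedy_run s w I2 g -> succeeds s w I2 g -> (1, Some 2) \in g,
      ~ exists rho, is_det_rule rho /\
          (forall inv : seq R, is_inventory inv ->
             succeeds s w inv (det_run s w rho inv))
    & forall mu, is_rand_rule mu ->
        1 / 2 <= failure_prob s w mu I1 \/ 1 / 2 <= failure_prob s w mu I2].
Proof.
move=> s w I1 I2; split.
- by split; [exact: feasible1 | exact: feasible2].
- exact: pivot_rooted1.
- exact: pivot_nested2.
- move=> [rho [rule ok]].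
  exact: (no_det_rule rho rule (ok _ inventory1) (ok _ inventory2)).
- exact: rand_rule_fails.
Qed.
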